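(* Let $A \in \mathcal M_d(\mathbb R)$ satisfy $\rho(A) < 1$, and let $\tau$ be a delay function such that, with $\sigma_1(t) = t - \tau(t)$ for $t \in \mathbb R_+$: $\inf_{s \in [0, t]} \tau(s) > 0$ for every $t \geq 0$; $\mathcal L(\sigma_1^{-1}(N)) = 0$ for every Lebesgue-measurable $N \subset \mathbb R$ with $\mathcal L(N) = 0$; and $\lim_{t \to +\infty} \sigma_1(t) = +\infty$. Let $h$ be the largest delay function associated with $\tau$, and let $x \in L^\infty_{\mathrm{loc}}(\lvert -h(0), +\infty), \mathbb R^d)$ be an $L^\infty$ solution of $$x(t) = A x(t - \tau(t)), \qquad t \geq 0,$$ with bounded initial condition $x_0 \in L^\infty(\lvert -h(0), 0), \mathbb R^d)$. Then $\lVert x_t\rVert_{L^\infty(\lvert -h(t), 0), \mathbb R^d)} \to 0$ as $t \to +\infty$.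
   Context: $\mathbb R_+ = [0, +\infty)$, $\mathbb R_+^\ast = (0, +\infty)$; $\mathcal M_d(\mathbb R)$ is the set of real $d \times d$ matrices, $d$ a positive integer, and $\rho(A)$ is the spectral radius of $A$; $\mathcal L$ is Lebesgue measure. For $a \leq b$ in $\mathbb R \cup \{\pm\infty\}$, $\lvert a, b)$ denotes $[a, b)$ if $a > -\infty$ and $(a, b)$ if $a = -\infty$. A \emph{delay function} is any function $\tau\colon \mathbb R_+ \to \mathbb R_+^\ast$. Its \emph{largest delay function} is $h\colon \mathbb R_+ \to \mathbb R_+^\ast \cup \{+\infty\}$, $h(t) = t - \inf_{s \in [t, +\infty)} (s - \tau(s))$. An \emph{a.e. solution} is a function $x\colon \lvert -h(0), +\infty) \to \mathbb R^d$ such that, for every $\widetilde x\colon \lvert -h(0), +\infty) \to \mathbb R^d$ equal to $x$ a.e., we have $\widetilde x(t) = A \widetilde x(t - \tau(t))$ for a.e. $t \in \mathbb R_+$. An \emph{$L^\infty$ solution} is a Lebesgue-measurable a.e. solution $x$ with $x \in L^\infty_{\mathrm{loc}}(\lvert -h(0), +\infty), \mathbb R^d)$. Its \emph{initial condition} is its restriction to $\lvert -h(0), 0)$. For $t \in \mathbb R_+$, $x_t\colon \lvert -h(t), 0) \to \mathbb R^d$ is defined by $x_t(s) = x(t + s)$. *)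

(* Defs.v *)
From mathcomp Require Import all_boot all_order all_algebra.
From mathcomp Require Import complex.
From mathcomp Require Import all_classical all_reals all_analysis.

Set Implicit Arguments.
Unset Strict Implicit.
Unset Printing Implicit Defensive.

Import Order.TTheory GRing.Theory Num.Theory.
Import numFieldNormedType.Exports.

Local Open Scope classical_set_scope.
Local Open Scope ring_scope.

(* [normc] is the real-valued modulus on [R[i]]; [eigenvalue] is stated for row
   vectors, which gives the same spectrum as column vectors. *)
Definition spectral_radius (R : realType) (d : nat) (A : 'M[R]_d) : R :=
  sup [set ComplexField.Normc.normc z | z in
         [set z : R[i] | eigenvalue (map_mx (real_complex R) A) z]].

(* [R] with the Lebesgue sigma-algebra (the Caratheodory sets of the outer
   measure extending the length of intervals), as opposed to the Borel one that
   [R] carries by default. *)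
Notation lebesgueTypeR R := (caratheodory_type (mu_ext (@wlength R idfun))).

Section L_infinity.
Variables (R : realType) (d : nat).

Local Notation leb := (@completed_lebesgue_measure R).

Definition lebesgue_null (N : set R) : Prop :=
  measurable (N : set (lebesgueTypeR R)) /\ leb N = 0%E.

(* Codomain [R] is Borel. *)
Definition lebesgue_measurable_fun (D : set R) (f : R -> 'cV[R]_d) : Prop :=
  forall i : 'I_d,
    measurable_fun (D : set (lebesgueTypeR R))
      (fun t : lebesgueTypeR R => f t i 0 : measurableTypeR R).

(* The norm on ['cV[R]_d] is the sup norm of the coordinates. *)
Definition Linf_norm (D : set R) (f : R -> 'cV[R]_d) : \bar R :=
  'N[leb]_+oo%E[(fun t => `|f t|%:E) \_ D].

Definition Linf (D : set R) (f : R -> 'cV[R]_d) : Prop :=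
  lebesgue_measurable_fun D f /\ (Linf_norm D f < +oo)%E.

Definition Linf_loc (D : set R) (f : R -> 'cV[R]_d) : Prop :=
  lebesgue_measurable_fun D f /\
  forall K : set R, compact K -> K `<=` D -> (Linf_norm K f < +oo)%E.

End L_infinity.

Section difference_equation.
Variable R : realType.

(* Functions on a subset [D] of [R] are represented by total functions on [R];
   only their values on [D] are relevant. In particular only the values of [tau]
   on [0, +oo) are ever used. *)

Definition delay_function (tau : R -> R) : Prop :=
  forall t, 0 <= t -> 0 < tau t.

Definition sigma1 (tau : R -> R) (t : R) : R := t - tau t.

Definition largest_delay (tau : R -> R) (t : R) : \bar R :=
  (t%:E - ereal_inf [set (s - tau s)%:E | s in `[t, +oo[])%E.

(* [|a, b)]: equal to [[a, b)] if [a] is finite, to [(-oo, b)] if [a = -oo]. *)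
Definition bar_itv (a b : \bar R) : set R := [set s | (a <= s%:E < b)%E].

Definition sol_domain (tau : R -> R) : set R :=
  bar_itv (- largest_delay tau 0)%E +oo%E.

(* [x_t] and its domain. *)
Definition segment (d : nat) (x : R -> 'cV[R]_d) (t : R) : R -> 'cV[R]_d :=
  fun s => x (t + s).

Definition segment_domain (tau : R -> R) (t : R) : set R :=
  bar_itv (- largest_delay tau t)%E 0%E.

Definition ae_solution (d : nat) (A : 'M[R]_d) (tau : R -> R)
    (x : R -> 'cV[R]_d) : Prop :=
  forall y : R -> 'cV[R]_d,
    {ae @completed_lebesgue_measure R,
      forall t, sol_domain tau t -> y t = x t} ->
    {ae @completed_lebesgue_measure R,
      forall t, 0 <= t -> y t = A *m y (t - tau t)}.

Definition Linf_solution (d : nat) (A : 'M[R]_d) (tau : R -> R)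
    (x : R -> 'cV[R]_d) : Prop :=
  ae_solution A tau x /\ Linf_loc (sol_domain tau) x.

End difference_equation.

(* Main.v *)
(* Since [rho(A) < 1], some norm [N] on [R^d] satisfies [N (A v) <= q N v] with
   [q < 1], so [f t := N (x t)] satisfies [f t <= q f (sigma1 t)] for a.e. [t >= 0].
   On [0, m] the delay is at least some [d > 0], so an essential bound of [f]
   for negative times propagates by steps of length [d] to all times. As
   [sigma1 t] tends to [+oo], each use of the inequality gains a factor [q] on some
   later half-line [T_k, +oo), and for [t] large the window of [x_t] lies in
   that half-line. *)
Require Import Defs.
From mathcomp Require Import all_boot all_order all_algebra.
From mathcomp Require Import complex.
From mathcomp Require Import all_classical all_reals all_analysis.
From mathcomp Require Import spectral lra ess_sup_inf.
Set Implicit Arguments.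
Unset Strict Implicit.
Unset Printing Implicit Defensive.
Import Order.TTheory GRing.Theory Num.Theory.
Import numFieldNormedType.Exports.
Local Open Scope classical_set_scope.
Local Open Scope ring_scope.

Local Notation normc := ComplexField.Normc.normc.

(** * Complex moduli and Schur triangularization *)

Lemma normc_ge0 (R : rcfType) (z : R[i]) : 0 <= normc z.
Proof. by case: z => a b; exact: sqrtr_ge0. Qed.

Lemma normc_real (R : rcfType) (r : R) : normc (real_complex R r) = `|r|.
Proof. by rewrite /normc /= expr0n /= addr0 sqrtr_sqr. Qed.

Lemma normc_sum_le (R : rcfType) (I : finType) (F : I -> R[i]) :
  normc (\sum_i F i) <= \sum_i normc (F i).
Proof.
elim/big_ind2: _ => [|a b c e ab ce|//].
  by rewrite -[0]/(0%:C)%C normc_real normr0.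
by rewrite (le_trans (le_normcD _ _))// lerD.
Qed.

Lemma eigenvalue_trig (F : fieldType) n (T : 'M[F]_n) z : is_trig_mx T ->
  reflect (exists i, z = T i i) (eigenvalue T z).
Proof.
move=> Ttrig; rewrite eigenvalue_root_char char_poly_trig//.
rewrite -(big_map (fun i => T i i) xpredT (fun x => 'X - x%:P)) root_prod_XsubC.
by apply: (iffP mapP) => [[i _ ->]|[i ->]]; exists i; rewrite ?mem_index_enum.
Qed.

Lemma normc_mulmx_le (R : rcfType) m n (B : 'M[R[i]]_(m, n)) (v : 'cV_n) i :
  normc ((B *m v) i 0) <= \sum_j normc (B i j) * normc (v j 0).
Proof.
rewrite mxE (le_trans (normc_sum_le _))// ler_sum// => j _.
by rewrite ComplexField.Normc.normcM.
Qed.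

(** The diagonal entries of a triangular matrix are its eigenvalues, and conjugation by [P]
    preserves the spectrum. *)
Lemma schur_real (R : realType) n (A : 'M[R]_n) : (0 < n)%N ->
  exists P T : 'M[R[i]]_n, [/\ P \in unitmx, is_trig_mx T,
    P *m map_mx (real_complex R) A = T *m P &
    forall i, normc (T i i) <= spectral_radius A].
Proof.
move=> n_gt0; set B := map_mx _ A.
have [P /unitarymx_unit Pu Ttrig] := Schur B n_gt0.
have ev := fun z => @eigenvalue_trig _ _ (conjmx P B) z Ttrig.
have evB : eigenvalue (conjmx P B) =1 eigenvalue B.
  move=> z; apply/idP/idP => [|zB].
    by apply: eigenvalue_conjmx; rewrite ?stablemx_unit ?row_free_unit.
  rewrite -(conjmxK B Pu) in zB; move: zB.
  by apply: eigenvalue_conjmx; rewrite ?stablemx_unit ?row_free_unit ?unitmx_inv.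
exists P, (conjmx P B); split=> //.
  by apply/simmxP => //; exact/eqP.
move=> i; apply: ub_le_sup => /=.
  (* [sup] is an upper bound only for a set that has one; the sum of the diagonal moduli is a crude
     one. *)
  exists (\sum_j normc (conjmx P B j j)) => _ [z /= + <-].
  rewrite -evB => /ev[j ->]; rewrite (bigD1 j)//= lerDl.
  by apply: sumr_ge0 => *; exact: normc_ge0.
by exists (conjmx P B i i) => //=; rewrite -evB; apply/ev; exists i.
Qed.

(** * A norm contracted by the matrix *)

Lemma exists_small_perturbation (R : realFieldType) (r S : R) : r < 1 -> 0 <= S ->
  exists e : R, [/\ 0 < e, e <= 1 & r + e * S < 1].
Proof.
move=> r1 S0; have D0 : 0 < S + 1 + (1 - r) by lra.
(* The denominator exceeds [S], so [e * S < 1 - r]; it also exceeds [1 - r], so [e <= 1]. *)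
exists ((1 - r) / (S + 1 + (1 - r))); split.
- by rewrite divr_gt0//; lra.
- by rewrite ler_pdivrMr//; lra.
- rewrite -ltrBrDl mulrAC ltr_pdivrMr// ltr_pM2l; lra.
Qed.

Lemma coord_le_norm (R : realType) n (v : 'cV[R]_n) i : `|v i 0| <= `|v|.
Proof.
by rewrite [leRHS]/Num.Def.normr/= mx_normrE; exact: (le_bigmax _ _ (i, 0)).
Qed.

Lemma norm_le_coord (R : realType) n (v : 'cV[R]_n) c : 0 <= c ->
  (forall i, `|v i 0| <= c) -> `|v| <= c.
Proof.
move=> c0 vc; rewrite [leLHS]/Num.Def.normr/= mx_normrE bigmax_le//= => -[i j] _.
by rewrite (ord1 j).
Qed.

(* After triangularization, the weights [e ^+ i] on the coordinates make the
   off-diagonal entries contribute at most [e * S]. *)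
Lemma adapted_norm (R : realType) n (A : 'M[R]_n) : (0 < n)%N ->
  spectral_radius A < 1 ->
  exists (N : 'cV[R]_n -> R) (q K : R), [/\ 0 <= q < 1, 0 <= K,
    forall v, N (A *m v) <= q * N v,
    forall v, N v <= K * `|v| & forall v, `|v| <= K * N v].
Proof.
move=> n_gt0 rA; have [P [T [Pu /is_trig_mxP Ttrig PA Tdiag]]] := schur_real A n_gt0.
pose S := \sum_i \sum_j normc (T i j).
have S0 : 0 <= S by do 2!apply: sumr_ge0 => ? _; exact: normc_ge0.
have [e [e0 e1 qS]] := exists_small_perturbation rA S0.
pose w (v : 'cV[R]_n) := P *m map_mx (real_complex R) v.
pose N v := \sum_(i < n) e ^+ i * normc (w v i 0).
have N0 v : 0 <= N v.
  by apply: sumr_ge0 => i _; rewrite mulr_ge0 ?normc_ge0 ?exprn_ge0 ?ltW.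
have eN v (i : 'I_n) : normc (w v i 0) <= (e ^+ i)^-1 * N v.
  rewrite ler_pdivlMl ?exprn_gt0// /N (bigD1 i)//= lerDl.
  by apply: sumr_ge0 => j _; rewrite mulr_ge0 ?normc_ge0 ?exprn_ge0 ?ltW.
pose K1 := \sum_(i < n) \sum_(j < n) e ^+ i * normc (P i j).
pose K2 := \sum_(i < n) \sum_(j < n) normc (invmx P i j) * (e ^+ j)^-1.
have K10 : 0 <= K1.
  by do 2!apply: sumr_ge0 => ? _; rewrite mulr_ge0 ?normc_ge0 ?exprn_ge0 ?ltW.
have K20 : 0 <= K2.
  do 2!apply: sumr_ge0 => ? _.
  by rewrite mulr_ge0 ?normc_ge0 ?invr_ge0 ?exprn_ge0 ?ltW.
exists N, (spectral_radius A + e * S), (K1 + K2); split.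
- rewrite qS andbT addr_ge0 ?mulr_ge0 ?(ltW e0)//.
  (* As [0 < n], [T] has a diagonal entry, which makes the spectral radius nonnegative. *)
  by rewrite (le_trans _ (Tdiag (Ordinal n_gt0)))// normc_ge0.
- exact: addr_ge0.
- move=> v; have wA : w (A *m v) = T *m w v.
    by rewrite /w map_mxM mulmxA PA mulmxA.
  rewrite /N wA (@le_trans _ _ (\sum_(i < n) \sum_(j < n)
      e ^+ i * (normc (T i j) * normc (w v j 0))))//.
    apply: ler_sum => i _; rewrite -mulr_sumr ler_wpM2l ?exprn_ge0 ?(ltW e0)//.
    exact: normc_mulmx_le.
  (* Column by column: the diagonal entry keeps its weight, entries with [i < j] vanish, and for
     [j < i] the weight satisfies [e ^+ i <= e ^+ j * e] because [e <= 1]. *)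
  rewrite exchange_big/= mulr_sumr ler_sum// => j _.
  rewrite (@le_trans _ _ (\sum_(i < n) (e ^+ j * normc (w v j 0)) *
      ((i == j)%:R * normc (T j j) + e * normc (T i j))))//.
    apply: ler_sum => i _; rewrite mulrA [leRHS]mulrAC ler_wpM2r ?normc_ge0//.
    have [->|ij] := eqVneq i j.
      rewrite mul1r ler_wpM2l ?exprn_ge0 ?(ltW e0)//.
      by rewrite lerDl mulr_ge0 ?normc_ge0 ?(ltW e0).
    rewrite mul0r add0r; case: (ltngtP i j) => [lt_ij|lt_ji|/val_inj/eqP].
    - rewrite Ttrig// -[0]/(0%:C)%C normc_real normr0 !mulr0//.
    - rewrite mulrA ler_wpM2r ?normc_ge0// -exprSr.
      by rewrite ler_wiXn2l// ltW.
    - by rewrite (negbTE ij).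
  rewrite -mulr_sumr mulrC ler_wpM2r//.
    by rewrite mulr_ge0 ?normc_ge0 ?exprn_ge0 ?ltW.
  rewrite big_split/= lerD//.
    rewrite (bigD1 j)//= eqxx mul1r big1 ?addr0// => i /negbTE ->.
    by rewrite mul0r.
  rewrite -mulr_sumr ler_wpM2l ?(ltW e0)// /S ler_sum// => i _.
  rewrite [leRHS](bigD1 j)//= lerDl.
  by apply: sumr_ge0 => *; exact: normc_ge0.
- move=> v; rewrite mulrDl ler_wpDr ?mulr_ge0//.
  rewrite /N /K1 mulr_suml ler_sum// => i _.
  rewrite -mulr_sumr -mulrA ler_wpM2l ?exprn_ge0 ?(ltW e0)//.
  rewrite (le_trans (normc_mulmx_le _ _ _))// mulr_suml ler_sum// => j _.
  by rewrite mxE normc_real ler_wpM2l ?normc_ge0 ?coord_le_norm.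
- move=> v; rewrite mulrDl ler_wpDl ?mulr_ge0//.
  apply: norm_le_coord => [|i]; first by rewrite mulr_ge0.
  have -> : `|v i 0| = normc ((invmx P *m w v) i 0).
    by rewrite /w mulKmx// mxE normc_real.
  rewrite (le_trans (normc_mulmx_le _ _ _))// /K2 mulr_suml [leRHS](bigD1 i)//=.
  rewrite ler_wpDr//.
    apply: sumr_ge0 => k _; rewrite mulr_ge0//; apply: sumr_ge0 => j _.
    by rewrite mulr_ge0 ?normc_ge0 ?invr_ge0 ?exprn_ge0 ?ltW.
  rewrite mulr_suml ler_sum// => j _.
  by rewrite -mulrA ler_wpM2l ?normc_ge0.
Qed.

(** * Translation of null sets *)

Local Notation leb := (@completed_lebesgue_measure _).

Lemma preimage_shift_ocitv (R : realType) (c : R) (X : set (ocitv_type R)) :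
  measurable X ->
  measurable ([set s | X (c + s)] : set (ocitv_type R)) /\
  wlength idfun [set s | X (c + s)] = wlength idfun X.
Proof.
move=> -[[a b] _ <-].
have -> : [set s : R | `]a, b]%classic (c + s)] = `](a - c), (b - c)]%classic.
  by apply/seteqP; split=> s /=; rewrite !in_itv/= ltrBlDl lerBrDl.
split; first by exists (a - c, b - c).
by rewrite !wlength_itv/= !lte_fin ltrD2r -!EFinB; case: ifP => // _; congr EFin; lra.
Qed.

(** The measure is the outer measure generated by interval lengths, so translating the interval
    covers of a null set gives covers of the same total length. *)
Lemma negligible_shift (R : realType) (c : R) (N : set R) :
  leb.-negligible N -> leb.-negligible [set s | N (c + s)].
Proof.
move=> [B [mB B0 NB]].
suff B'0 : leb [set s | B (c + s)] = 0%E :> \bar R.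
  exists [set s | B (c + s)]; split => //; last by move=> s /NB.
  (* A set of outer measure zero satisfies the Caratheodory criterion. *)
  apply: le_caratheodory_measurable => X.
  set B' := [set s | B (c + s)] in B'0 *.
  suff H : (leb (X `&` B') + leb (X `&` ~` B') <= leb X :> \bar R)%E by exact: H.
  have -> : leb (X `&` B') = 0%E.
    apply/eqP; rewrite eq_le; apply/andP; split; last exact: mu_ext_ge0.
    by rewrite -B'0; apply: le_mu_ext; exact: subIsetr.
  by rewrite add0e; apply: le_mu_ext; exact: subIsetl.
apply/eqP; rewrite eq_le; apply/andP; split; last first.
  exact: mu_ext_ge0.
rewrite -B0; apply: le_ereal_inf => _ [F [mF BF] <-].
exists (fun k => [set s | F k (c + s)]).
  split => [k|s /BF [k _ Fk]]; last by exists k.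
  by have [] := preimage_shift_ocitv c (mF k).
by apply: eq_eseriesr => k _; have [] := preimage_shift_ocitv c (mF k).
Qed.

(** * Propagation of essential bounds along the delay *)

Lemma ae_le_initial_bound (R : realType) (tau : R -> R) (D : set R) (f : R -> R)
    (q M : R) :
  0 <= q <= 1 -> 0 <= M -> delay_function tau ->
  (forall t : R, 0 <= t -> 0 < inf [set tau s | s in `[0, t]]) ->
  (forall N : set R, leb.-negligible N ->
     leb.-negligible [set t | 0 <= t /\ N (sigma1 tau t)]) ->
  (forall t : R, 0 <= t -> D (sigma1 tau t)) ->
  {ae leb, forall t : R, 0 <= t -> f t <= q * f (sigma1 tau t)} ->
  {ae leb, forall t : R, D t -> t < 0 -> f t <= M} ->
  {ae leb, forall t : R, D t -> f t <= M}.
Proof.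
move=> /andP[q0 q1] M0 tau0 tau_inf sigma_null Dsigma f_eq f_init.
have boundT (m : nat) : leb.-negligible [set t | [/\ D t, t <= m%:R & M < f t]].
  set d := inf [set tau s | s in `[0, m%:R]].
  have d0 : 0 < d by exact: tau_inf.
  have d_le t : 0 <= t -> t <= m%:R -> d <= tau t.
    move=> t0 tm; apply: ge_inf; last by exists t => //=; rewrite in_itv/= t0.
    by exists 0 => _ [s /= + <-]; rewrite in_itv/= => /andP[s0 _]; exact/ltW/tau0.
  have step (n : nat) :
      leb.-negligible [set t | [/\ D t, t <= m%:R, t < d *+ n & M < f t]].
    elim: n => [|n IHn].
      apply: negligibleS f_init => t /= [Dt _ t0 Mf] /(_ Dt).
      by rewrite mulr0n in t0; move=> /(_ t0); rewrite leNgt Mf.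
    (* A time below [d *+ n.+1] with [M < f t] violates the initial bound, violates the inequality,
       or is sent by [sigma1] to such a time below [d *+ n], since [q * M <= M]. *)
    apply: negligibleS (negligibleU (negligibleU f_init f_eq) (sigma_null _ IHn)).
    move=> t /= [Dt tm tn Mf]; have [t0|t0] := ltP t 0.
      by left; left => /(_ Dt isT); rewrite leNgt Mf.
    have [ft|nft] := pselect (f t <= q * f (sigma1 tau t)); last first.
      by left; right => /(_ isT).
    right; split=> //; split.
    - exact: Dsigma.
    - by rewrite /sigma1 lerBlDr (le_trans tm)// lerDl ltW// tau0.
    - by rewrite /sigma1 ltrBlDr (lt_le_trans tn)// mulrSr lerD2l d_le.
    - rewrite ltNge; apply/negP => fM.
      have : f t <= M by rewrite (le_trans ft)// (le_trans (ler_wpM2l q0 fM))// ler_piMl.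
      by rewrite leNgt Mf.
  apply: negligibleS (negligible_bigcup step) => t /= [Dt tm Mf].
  (* This many steps of length [d] lead past [m]. *)
  exists (Num.truncn (m%:R / d)).+1 => //=; split=> //.
  rewrite (le_lt_trans tm)// -[ltRHS]mulr_natr -ltr_pdivrMl// mulrC.
  exact: truncnS_gt.
apply: negligibleS (negligible_bigcup boundT) => t /= /not_implyP[Dt /negP].
rewrite -ltNge => Mf; exists (Num.truncn t).+1 => //=; split=> //.
exact/ltW/truncnS_gt.
Qed.

Lemma ae_geometric_decay (R : realType) (tau : R -> R) (f : R -> R)
    (q M : R) :
  0 <= q ->
  (forall N : set R, leb.-negligible N ->
     leb.-negligible [set t | 0 <= t /\ N (sigma1 tau t)]) ->
  sigma1 tau t @[t --> +oo] --> +oo ->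
  {ae leb, forall t : R, 0 <= t -> f t <= q * f (sigma1 tau t)} ->
  {ae leb, forall t : R, 0 <= t -> f t <= M} ->
  forall k, exists2 T, 0 <= T & {ae leb, forall t : R, T <= t -> f t <= q ^+ k * M}.
Proof.
move=> q0 sigma_null sigma_lim f_eq fM; elim=> [|k [T T0 IHk]].
  by exists 0 => //; rewrite expr0 mul1r.
have [T1 [_ T1P]] := (cvgryPge _).1 sigma_lim T.
(* [T1P] holds for [T1 < t] only, hence the [+ 1] for a closed half-line; the maximum keeps [t]
   where the inequality is available. *)
exists (Num.max 0 (T1 + 1)); first by rewrite le_max lexx.
have := negligibleU f_eq (sigma_null _ IHk); apply: negligibleS => t /= Nt.
have {Nt} [tT ft] : Num.max 0 (T1 + 1) <= t /\ ~ f t <= q ^+ k.+1 * M.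
  exact/not_implyP.
have [t0 tT1] : 0 <= t /\ T1 < t.
  by move: tT; rewrite ge_max => /andP[-> t1]; split=> //; rewrite (lt_le_trans _ t1)// ltrDl.
have [le_f|] := pselect (f t <= q * f (sigma1 tau t)); last first.
  by left => /(_ t0).
right; split=> // /(_ (T1P _ tT1)) fs; apply: ft.
by rewrite (le_trans le_f)// exprS -mulrA ler_wpM2l.
Qed.

(** * Domains and essential suprema *)

(** Expresses the domains of [x] and [x_t] through the infimum of [sigma1], treating finite and
    infinite [h] at once. *)
Lemma oppe_largest_delay_le (R : realType) (tau : R -> R) (t s : R) :
  (- largest_delay tau t <= s%:E)%E =
  (ereal_inf [set (sigma1 tau u)%:E | u in `[t, +oo[] <= (t + s)%:E)%E.
Proof.
rewrite /largest_delay /sigma1 oppeB ?fin_num_adde_defr// addeC.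
by rewrite leeBlDr// addeC EFinD.
Qed.

(** The norm is taken of the extension by zero outside [D], where [0 <= c] gives the bound. *)
Lemma Linf_norm_leP (R : realType) d (D : set R) (f : R -> 'cV[R]_d) (c : R) :
  0 <= c -> (Linf_norm D f <= c%:E)%E <-> {ae leb, forall t : R, D t -> `|f t| <= c}.
Proof.
move=> c0.
(* ['N_+oo] is the essential supremum only when the whole space has positive measure. *)
have leb_gt0 : (0 < leb [set: R])%E.
  rewrite (@lt_le_trans _ _ (leb (`]0, 1]%classic : set R)))//.
    have : (lebesgue_measure (`]0%R, 1%R]%classic : set R) = 1)%E.
      by rewrite lebesgue_measure_itv/= lte01 oppr0 adde0.
    by move=> /= h; rewrite [X in (_ < X)%E]h.
  exact: le_mu_ext.
rewrite /Linf_norm unlock leb_gt0; split=> [/ess_supP|H].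
  apply: negligibleS => t /= ft Dft; apply: ft => Dt.
  by move: Dft; rewrite patchE mem_set//= lee_fin normr_id.
apply/ess_supP; apply: negligibleS H => t /= ft Dft; apply: ft.
rewrite patchE; case: ifPn => [/set_mem/Dft|_] /=; last by rewrite normr0 lee_fin.
by rewrite lee_fin normr_id.
Qed.

Theorem corollary5p4 (R : realType) (d : nat) (d_gt0 : (0 < d)%N)
    (A : 'M[R]_d) (tau : R -> R) (x : R -> 'cV[R]_d)
    (rhoA : spectral_radius A < 1)
    (tau_delay : delay_function tau)
    (tau_inf : forall t : R, 0 <= t -> 0 < inf [set tau s | s in `[0, t]])
    (sigma1_null : forall N : set R, lebesgue_null N ->
       lebesgue_null [set t | 0 <= t /\ N (sigma1 tau t)])
    (sigma1_lim : sigma1 tau t @[t --> +oo] --> +oo)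
    (x_sol : Linf_solution A tau x)
    (x0_bounded : Linf (segment_domain tau 0) (segment x 0)) :
  Linf_norm (segment_domain tau t) (segment x t) @[t --> +oo] --> 0%E.
Proof.
have [N [q [K [/andP[q0 q1] K0 NA NK KN]]]] := adapted_norm d_gt0 rhoA.
(* The hypothesis concerns measurable null sets; a negligible set is enclosed in one. *)
have sigma_null (Z : set R) : leb.-negligible Z ->
    leb.-negligible [set t | 0 <= t /\ Z (sigma1 tau t)].
  move=> [B [mB B0 ZB]]; have [mB' B'0] := sigma1_null _ (conj mB B0).
  by exists [set t | 0 <= t /\ B (sigma1 tau t)]; split => // t [t0 /ZB].
have [/(_ x (aeW _ (fun t _ => erefl))) x_eq _] := x_sol.
have f_eq : {ae leb, forall t : R, 0 <= t -> N (x t) <= q * N (x (sigma1 tau t))}.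
  apply: negligibleS x_eq => t /= ft xt; apply: ft => t0.
  by rewrite (xt t0) NA.
have domE t : sol_domain tau t =
    (ereal_inf [set (sigma1 tau u)%:E | u in `[0%R, +oo[] <= t%:E)%E.
  by rewrite /sol_domain /bar_itv /= oppe_largest_delay_le add0r ltry andbT.
have segE t s : segment_domain tau t s ->
    (ereal_inf [set (sigma1 tau u)%:E | u in `[t, +oo[] <= (t + s)%:E)%E.
  by rewrite /segment_domain /bar_itv /= oppe_largest_delay_le => /andP[].
have [C C0 xC] : exists2 C : R, 0 <= C &
    {ae leb, forall s : R, segment_domain tau 0 s -> `|segment x 0 s| <= C}.
  case: x0_bounded => _ bx; exists (Num.max 0 (fine (Linf_norm (segment_domain tau 0) (segment x 0)))).
    by rewrite le_max lexx.
  apply/Linf_norm_leP; first by rewrite le_max lexx.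
  by case: Linf_norm bx => [r _| |]//=; rewrite ?lee_fin ?le_max ?lexx ?orbT ?leNye.
have fM : {ae leb, forall t : R, sol_domain tau t -> N (x t) <= K * C}.
  apply: (ae_le_initial_bound (q := q) (tau := tau)) => //.
  - by rewrite q0 ltW.
  - exact: mulr_ge0.
  - move=> t t0; rewrite domE; apply: ereal_inf_lbound; exists t => //=.
    by rewrite in_itv/= t0.
  - apply: negligibleS xC => t /= ft xt; apply: ft => Dt t0.
    rewrite (le_trans (NK _))// ler_wpM2l//.
    have := xt; rewrite /segment add0r; apply.
    by move: Dt; rewrite /sol_domain /segment_domain /bar_itv /= ltry andbT lte_fin t0 andbT.
have fM0 : {ae leb, forall t : R, 0 <= t -> N (x t) <= K * C}.
  apply: negligibleS fM => t /= ft Dt; apply: ft => t0; apply: Dt.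
  (* [[0, +oo)] lies in the domain because [sigma1 tau 0 = - tau 0] is negative. *)
  rewrite domE; apply: (@le_trans _ _ (sigma1 tau 0)%:E).
    by apply: ereal_inf_lbound; exists 0 => //=; rewrite in_itv/= lexx.
  by rewrite lee_fin /sigma1 sub0r (le_trans _ t0)// oppr_le0 ltW// tau_delay.
have decay := ae_geometric_decay q0 sigma_null sigma1_lim f_eq fM0.
have small (e : R) : 0 < e ->
    \forall t \near +oo, (Linf_norm (segment_domain tau t) (segment x t) <= e%:E)%E.
  move=> e0.
  (* [K * C] bounds [N (x t)], [q ^+ k] is the decay, and the outer [K] returns from [N] to the sup
     norm. *)
  have [k Kk] : exists k : nat, K * (q ^+ k * (K * C)) <= e.
    have : (fun k => K * (q ^+ k * (K * C))) @ \oo --> (0 : R).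
      rewrite -[X in _ --> X](_ : K * (0 * (K * C)) = 0); last by rewrite mul0r mulr0.
      apply: cvgM; first exact: cvg_cst.
      apply: cvgM; last exact: cvg_cst.
      by apply: cvg_expr; rewrite ger0_norm.
    move=> /cvgr_le/(_ e e0) [k _ Hk]; exists k; exact: (Hk k (leqnn k)).
  have [T T0 fT] := decay k.
  have [T1 [_ T1P]] := (cvgryPge _).1 sigma1_lim T.
  near=> t; apply/Linf_norm_leP; first exact: ltW.
  (* For [s] in the window, [t + s] is at least the infimum of [sigma1] over [[t, +oo)], which is at
     least [T] once [T1 < t]. *)
  apply: negligibleS (negligible_shift t fT) => s /= xs ft; apply: xs => /segE Ds.
  rewrite (le_trans (KN _))// (le_trans _ Kk)// ler_wpM2l// ft//.
  rewrite -lee_fin (le_trans _ Ds)//; apply/ereal_infP => _ [u /= + <-].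
  rewrite in_itv/= andbT => tu; rewrite lee_fin; apply: T1P.
  by apply: lt_le_trans tu; near: t; apply: nbhs_pinfty_gt; exact: num_real.
(* Convergence in the extended reals: the norms are eventually finite, and their real values tend to
   0. *)
apply/fine_cvgP; split.
  near=> t; have t1 : (Linf_norm (segment_domain tau t) (segment x t) <= 1%:E)%E.
    by near: t; exact: small.
  by rewrite ge0_fin_numE ?(le_lt_trans t1) ?ltry// Lnorm_ge0.
apply/cvgrPdist_le => e e0; near=> t.
have te : (Linf_norm (segment_domain tau t) (segment x t) <= e%:E)%E.
  by near: t; exact: small.
have n0 : (0 <= Linf_norm (segment_domain tau t) (segment x t))%E by exact: Lnorm_ge0.
rewrite sub0r normrN ger0_norm ?fine_ge0// -lee_fin fineK//.
by rewrite ge0_fin_numE// (le_lt_trans te)// ltry.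
Unshelve. all: by end_near.
Qed.
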